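(* Let $G$ be a graph, $\theta$ a real number, and $X \subseteq V(G)$ with $|X|>1$. The following are equivalent: (a) $X$ is a maximal $\theta$-Tutte set in $G$ (maximal under inclusion among $\theta$-Tutte sets); (b) $X$ is a maximal $\theta$-extreme set in $G$ (maximal under inclusion among $\theta$-extreme sets); (c) $X$ is a maximal $\theta$-nice set in $G$, i.e. $\mathrm{mult}(\theta, G\setminus \{u,v\})=\mathrm{mult}(\theta,G)+2$ for all distinct $u,v\in X$, and no proper superset of $X$ has this property.
   Context: All graphs are finite and simple. For a graph $G$ on $n$ vertices, let $p(G,r)$ be the number of $r$-matchings of $G$ ($p(G,0)=1$); the matching polynomial is $\mu(G,x)=\sum_{r=0}^{\lfloor n/2\rfloor}(-1)^r p(G,r)x^{n-2r}$ (the graph with no vertices has $\mu=1$). For real $\theta$, $\mathrm{mult}(\theta,G)$ is the multiplicity of $\theta$ as a root of $\mu(G,x)$ (it is $0$ if $\theta$ is not a root). For $X\subseteq V(G)$, $G\setminus X$ is the graph obtained by deleting the vertices of $X$ and their incident edges; $G\setminus u$, $G\setminus uv$ mean $G\setminus\{u\}$, $G\setminus\{u,v\}$. A vertex $u$ is $\theta$-essential in $G$ if $\mathrm{mult}(\theta,G\setminus u)=\mathrm{mult}(\theta,G)-1$. A connected graph is $\theta$-critical if every one of its vertices is $\theta$-essential in it; $c_\theta(G)$ denotes the number of connected components of $G$ that are $\theta$-critical. A set $X\subseteq V(G)$ is a $\theta$-Tutte set if $c_\theta(G\setminus X)=\mathrm{mult}(\theta,G)+|X|$, and a $\theta$-extreme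 set if $\mathrm{mult}(\theta,G\setminus X)=\mathrm{mult}(\theta,G)+|X|$. *)

(* Defs.v *)
From HB Require Import structures.
From mathcomp Require Import all_boot all_order all_algebra.
Set Implicit Arguments. Unset Strict Implicit. Unset Printing Implicit Defensive.
Import Order.TTheory GRing.Theory Num.Theory.
Local Open Scope ring_scope.

(* A finite simple graph G is given by a finite vertex type T and a symmetric,
   irreflexive adjacency relation e : rel T; V(G) = [set: T].
   Subgraphs G \ X are represented by the induced subgraph on the vertex set
   S = ~: X; in general, G[S] denotes the subgraph induced on S : {set T}. *)

Section Graph.
Variables (T : finType) (e : rel T).

Definition edges (S : {set T}) : {set {set T}} :=
  [set E : {set T} | (E \subset S) &&
     [exists x : T, exists y : T, e x y && (E == [set x; y])]].

Definition is_matching (S : {set T}) (M : {set {set T}}) : bool :=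
  (M \subset edges S) && trivIset M.

Definition nmatch (S : {set T}) (r : nat) : nat :=
  #|[set M : {set {set T}} | is_matching S M & #|M| == r]|.

Definition match_poly (R : nzRingType) (S : {set T}) : {poly R} :=
  \sum_(r < (#|S| %/ 2).+1)
     ((-1) ^+ r * (nmatch S r)%:R) *: 'X^(#|S| - 2 * r).

Definition mult (R : fieldType) (theta : R) (S : {set T}) : nat :=
  mup theta (match_poly R S).

Definition adjS (S : {set T}) : rel T :=
  fun x y => [&& x \in S, y \in S & e x y].

Definition components (S : {set T}) : {set {set T}} :=
  [set [set y in S | connect (adjS S) x y] | x in S].

Definition connectedS (C : {set T}) : bool :=
  (C != set0) && [forall x in C, forall y in C, connect (adjS C) x y].

(* u is theta-essential in G[S]: mult(theta, G[S]\u) = mult(theta, G[S]) - 1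
   (stated without truncated subtraction) *)
Definition essential (R : fieldType) (theta : R) (S : {set T}) (u : T) : bool :=
  (mult theta (S :\ u)).+1 == mult theta S.

Definition critical (R : fieldType) (theta : R) (C : {set T}) : bool :=
  connectedS C && [forall u in C, essential theta C u].

Definition ncrit (R : fieldType) (theta : R) (S : {set T}) : nat :=
  #|[set C in components S | critical theta C]|.

Definition tutte_set (R : fieldType) (theta : R) (X : {set T}) : bool :=
  ncrit theta (~: X) == (mult theta [set: T] + #|X|)%N.

Definition extreme_set (R : fieldType) (theta : R) (X : {set T}) : bool :=
  mult theta (~: X) == (mult theta [set: T] + #|X|)%N.

Definition nice_set (R : fieldType) (theta : R) (X : {set T}) : bool :=
  [forall u in X, forall v in X,
     (u != v) ==> (mult theta (~: [set u; v]) == (mult theta [set: T] + 2)%N)].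

Definition maximal_set (P : {set T} -> bool) (X : {set T}) : Prop :=
  P X /\ forall Y : {set T}, X \proper Y -> ~~ P Y.

End Graph.

(* Main.v *)
(* Write [m S] for the multiplicity of [theta] in the induced subgraph on [S].  For
   arbitrary real vertex weights the weighted matching polynomial satisfies the Rayleigh
   inequality [mu(S-u) mu(S-v) >= mu(S) mu(S-u-v)].  Shifting the weight of a third
   vertex [w] by [s] makes the gap a nonnegative quadratic in [s], so its discriminant is
   nonpositive; comparing orders of vanishing at [theta] in this discriminant inequality
   shows both that three vertices, any two of which raise [m] by 2, together raise it by
   3 (hence nice sets with at least two elements are extreme), and that among essential
   vertices the relation "[m (S-u-v) >= m (S-u)]" is transitive, which is Gallai's lemma:
   critical graphs have [m = 1].  If [X] is a maximal extreme set then the complement of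
   [X] has no positive vertex, so essential vertices fill whole components and [m] counts
   the critical components, i.e. [X] is a Tutte set. *)

Require Import Defs.
From HB Require Import structures.
From mathcomp Require Import all_boot all_order all_algebra.
From mathcomp Require Import zify ring.
Import Order.TTheory GRing.Theory Num.Theory.
Local Open Scope ring_scope.

Set Implicit Arguments.
Unset Strict Implicit.
Unset Printing Implicit Defensive.

(** * Vertex-weighted matching polynomials *)

Section WeightedMatchingPolynomial.
Variables (T : finType) (e : rel T).
Hypotheses (e_sym : symmetric e) (e_irr : irreflexive e).
Implicit Types (S C : {set T}) (M : {set {set T}}) (u v w z : T).

Lemma setD1AC S u v : S :\ u :\ v = S :\ v :\ u.
Proof. by rewrite !setDDl setUC. Qed.

Lemma setC_D1 (X : {set T}) u : ~: X :\ u = ~: (u |: X).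
Proof. by rewrite setDE -setCU setUC. Qed.

(** * Edges and matchings of induced subgraphs *)

Lemma edgesP S (E : {set T}) :
  reflect (exists x y, [/\ e x y, x \in S, y \in S & E = [set x; y]])
          (E \in edges e S).
Proof.
rewrite inE; apply: (iffP andP) => [[sES /existsP[x /existsP[y]]]|].
  case/andP=> exy /eqP eqE; exists x, y; split=> //;
    by apply: (subsetP sES); rewrite eqE !inE eqxx ?orbT.
case=> x [y [exy xS yS ->]]; split; first by rewrite subUset !sub1set xS.
by apply/existsP; exists x; apply/existsP; exists y; rewrite exy eqxx.
Qed.

Lemma cover_matching S M : is_matching e S M -> cover M \subset S.
Proof.
case/andP=> /subsetP sM _; apply/bigcupsP => E /sM.
by rewrite inE => /andP[].
Qed.

Lemma is_matchingD1 S u M :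
  is_matching e (S :\ u) M = is_matching e S M && (u \notin cover M).
Proof.
apply/idP/andP => [mM|[/andP[/subsetP sM tM] uM]].
  split; last first.
    by apply/negP => /(subsetP (cover_matching mM)); rewrite !inE eqxx.
  case/andP: mM => /subsetP sM tM; rewrite /is_matching tM andbT; apply/subsetP => E /sM.
  by rewrite !inE subsetD1 => /andP[/andP[-> _] ->].
rewrite /is_matching tM andbT; apply/subsetP => E EM.
move: (sM _ EM); rewrite !inE subsetD1 => /andP[-> ->]; rewrite andbT /=.
by apply: contra uM => uE; apply/bigcupP; exists E.
Qed.

Lemma card_edge S (E : {set T}) : E \in edges e S -> #|E| = 2.
Proof.
case/edgesP=> x [y [exy _ _ ->]]; rewrite cards2.
by case: eqP exy => // ->; rewrite e_irr.
Qed.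

Lemma card_cover_matching S M : is_matching e S M -> #|cover M| = (2 * #|M|)%N.
Proof.
case/andP=> /subsetP sM /eqP <-.
rewrite (eq_bigr (fun=> 2%N)) ?sum_nat_const 1?mulnC //.
by move=> E /sM /card_edge.
Qed.

Lemma setU2_inj u v v' : v != u -> v' != u -> [set u; v] = [set u; v'] -> v = v'.
Proof.
move=> vu v'u /setP /(_ v); rewrite !inE eqxx orbT (negPf vu) /=.
by move/esym/eqP.
Qed.

Lemma e_neq u v : e u v -> v != u.
Proof. by case: eqP => // ->; rewrite e_irr. Qed.

Lemma is_matchingU1 S u v M : u \in S -> v \in S -> e u v ->
  is_matching e (S :\ u :\ v) M ->
  is_matching e S ([set u; v] |: M) /\ [set u; v] \notin M.
Proof.
move=> uS vS euv mM; have cM := cover_matching mM; case/andP: mM => /subsetP sM tM.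
have dM : {in M, forall B : {set T}, [disjoint [set u; v] & B]}.
  move=> B BM; have: B \subset S :\ u :\ v by move: (sM _ BM); rewrite inE => /andP[].
  by rewrite !subsetD1 disjoints_subset subUset !sub1set !inE => /andP[/andP[_ ->] ->].
have M0 : set0 \notin M by apply/negP => /sM /card_edge; rewrite cards0.
have [tE ->] := trivIsetU1 dM tM M0; split=> //.
rewrite /is_matching tE andbT; apply/subsetP => E; rewrite in_setU1.
case/orP=> [/eqP->|/sM]; first by apply/edgesP; exists u, v.
by rewrite !inE !subsetD1 => /andP[/andP[/andP[-> _] _] ->].
Qed.

Lemma is_matchingD1_edge S u v M : [set u; v] \in M -> is_matching e S M ->
  is_matching e (S :\ u :\ v) (M :\ [set u; v]).
Proof.
move=> EM mM; have tM : trivIset M by case/andP: mM.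
rewrite !is_matchingD1 coverD1 // !inE !eqxx ?orbT !andbT /=.
case/andP: mM => sM _; rewrite /is_matching (trivIsetS _ tM) ?subsetDl // andbT.
by apply: subset_trans sM; rewrite subsetDl.
Qed.

Section Weights.
Variable K : comNzRingType.

(** Every vertex has its own weight so that a single weight can be varied; the constant weight ['X]
    gives the matching polynomial, a constant weight [a] its value at [a]. *)
Definition wmatch (y : T -> K) S : K :=
  \sum_(M | is_matching e S M) (-1) ^+ #|M| * \prod_(z in S :\: cover M) y z.

Lemma eq_wmatch (y y' : T -> K) S :
  {in S, y =1 y'} -> wmatch y S = wmatch y' S.
Proof.
move=> yy'; apply: eq_bigr => M _; congr (_ * _); apply: eq_bigr => z.
by rewrite inE => /andP[_ /yy'].
Qed.

Lemma wmatch0 (y : T -> K) : wmatch y set0 = 1.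
Proof.
rewrite /wmatch (bigD1 set0) /=; last first.
  by rewrite /is_matching sub0set; apply/trivIsetP => A B; rewrite inE.
rewrite cards0 mul1r set0D big_set0 big1 ?addr0 // => M /andP[/andP[/subsetP sM _]].
case/set0Pn=> E /sM /edgesP[x [z [_]]]; by rewrite inE.
Qed.

Lemma wmatch_unmatched (y : T -> K) S u : u \in S ->
  \sum_(M | is_matching e S M && (u \notin cover M))
     (-1) ^+ #|M| * \prod_(z in S :\: cover M) y z = y u * wmatch y (S :\ u).
Proof.
move=> uS; rewrite /wmatch big_distrr /=.
apply: eq_big => M; first by rewrite is_matchingD1.
case/andP=> _ uM; rewrite mulrCA (bigD1 u) ?inE ?uM //=; congr (_ * (_ * _)).
by apply: eq_bigl => z; rewrite !inE; do ![case: (_ \in _) | case: (_ == _)].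
Qed.

(** Inserting [[set u; v]] is a bijection from the matchings of [S :\ u :\ v] onto those of [S]
    containing that edge; the extra edge flips the sign. *)
Lemma wmatch_matched (y : T -> K) S u v : u \in S -> v \in S -> e u v ->
  \sum_(M | is_matching e S M && ([set u; v] \in M))
     (-1) ^+ #|M| * \prod_(z in S :\: cover M) y z = - wmatch y (S :\ u :\ v).
Proof.
move=> uS vS euv; rewrite /wmatch -sumrN.
rewrite (reindex_onto (fun M => [set u; v] |: M) (fun M => M :\ [set u; v])) /=; last first.
  by move=> M /andP[_ EM]; rewrite setD1K.
apply: eq_big => M.
  apply/andP/idP => [[/andP[mM _] /eqP eqM]|mM].
    have := is_matchingD1_edge (setU11 _ _) mM; by rewrite eqM.
  have [-> nE] := is_matchingU1 uS vS euv mM.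
  by rewrite setU11 setU1K.
case/andP=> /andP[mM _] /eqP eqM.
have mM' : is_matching e (S :\ u :\ v) M.
  by have := is_matchingD1_edge (setU11 _ _) mM; rewrite eqM.
have [_ nE] := is_matchingU1 uS vS euv mM'.
rewrite cardsU1 nE exprD expr1 mulN1r mulNr; congr (- (_ * _)).
apply: eq_bigl => z; rewrite /cover big_setU1 //= -/(cover M) !inE.
by do ![case: (_ \in _) | case: (_ == _)].
Qed.

(** Matchings are sorted by whether they cover [u] and, if so, by the partner of [u]. *)
Lemma wmatch_rec (y : T -> K) S u : u \in S ->
  wmatch y S = y u * wmatch y (S :\ u)
             - \sum_(v in S :\ u | e u v) wmatch y (S :\ u :\ v).
Proof.
move=> uS; rewrite {1}/wmatch (bigID (fun M => u \notin cover M)) /=.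
rewrite wmatch_unmatched //; congr (_ + _).
pose Q v := (v \in S :\ u) && e u v.
(* For matchings of [S], the default [u] arises only when [u] is uncovered. *)
pose partner M := odflt u [pick v | Q v & [set u; v] \in M].
have QP v : Q v -> [/\ v \in S, v != u & e u v].
  by rewrite /Q !inE => /andP[/andP[-> ->] ->].
have partnerP M : is_matching e S M -> ~~ (u \notin cover M) ->
    Q (partner M) /\ [set u; partner M] \in M.
  move=> mM; rewrite negbK => /bigcupP[E EM uE]; rewrite /partner.
  case: pickP => [v /andP[] //|/= nQ].
  have /edgesP[a [b [eab aS bS Eab]]] : E \in edges e S.
    by case/andP: mM => /subsetP /(_ _ EM).
  have: (u == a) || (u == b) by move: uE; rewrite Eab !inE.
  case/orP=> /eqP Eu.
    by have := nQ b; rewrite /Q !inE Eu bS eab (e_neq eab) -Eab EM.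
  have eba : e b a by rewrite e_sym.
  by have := nQ a; rewrite /Q !inE Eu aS eba (e_neq eba) setUC -Eab EM.
rewrite (partition_big partner Q) /=; last first.
  by move=> M /andP[mM uM]; have [] := partnerP M mM uM.
rewrite -sumrN; apply: eq_bigr => v /[dup] Qv /QP[vS vu euv].
rewrite -wmatch_matched //; apply: eq_bigl => M.
apply/andP/andP => [[/andP[mM uM] /eqP <-]|[mM EM]].
  by split=> //; have [] := partnerP M mM uM.
have uM : ~~ (u \notin cover M).
  by rewrite negbK; apply/bigcupP; exists [set u; v]; rewrite // !inE eqxx.
have [/QP[_ pu _] pM] := partnerP M mM uM.
rewrite mM uM; split=> //; apply/eqP; apply: (@setU2_inj u) => //.
have tM : trivIset M by case/andP: mM.
have uE x : u \in [set u; x] by rewrite !inE eqxx.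
by rewrite -(def_pblock tM EM (uE v)) (def_pblock tM pM (uE _)).
Qed.

(** Induction on [#|A|]: a vertex of [A] has no neighbour in [B], so expanding both sides at it
    gives matching terms. *)
Lemma wmatchU (y : T -> K) (A B : {set T}) : [disjoint A & B] ->
  {in A & B, forall a b, ~~ e a b} ->
  wmatch y (A :|: B) = wmatch y A * wmatch y B.
Proof.
have [n] := ubnP #|A|; elim: n A => // n IHn A ltA dAB nAB.
have [->|[u uA]] := set_0Vmem A; first by rewrite set0U wmatch0 mul1r.
have uB : u \notin B by apply: contraL dAB => uB; apply/pred0Pn; exists u; apply/andP.
have IH (A' : {set T}) : A' \subset A :\ u ->
    wmatch y (A' :|: B) = wmatch y A' * wmatch y B.
  move=> sA'; have sA'A : A' \subset A := subset_trans sA' (subsetDl _ _).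
  apply: IHn => [||a b aA' bB].
  - by rewrite -ltnS (leq_ltn_trans _ ltA) // (cardsD1 u A) uA ltnS subset_leq_card.
  - exact: disjointWl dAB.
  - by apply: nAB => //; apply: (subsetP sA'A).
rewrite (@wmatch_rec y (A :|: B) u) ?inE ?uA // (@wmatch_rec y A u) //.
have -> : (A :|: B) :\ u = (A :\ u) :|: B.
  apply/setP => z; rewrite !inE; case: eqP => // ->; by rewrite (negPf uB).
rewrite IH // mulrBl -mulrA; congr (_ - _); rewrite big_distrl /=.
apply: eq_big => [v|v /andP[vAB euv]].
  rewrite !inE; case: (boolP (v \in B)) => [vB|]; last by rewrite orbF.
  by rewrite (negPf (nAB _ _ uA vB)) !andbF.
have vB : v \notin B by apply: contraL euv => /(nAB _ _ uA).
rewrite -IH ?subsetDl //; congr wmatch.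
by apply/setP => z; rewrite !inE; case: eqP => // ->; rewrite (negPf vB).
Qed.

End Weights.

(** * Specialisation to the matching polynomial *)

Lemma horner_wmatchX (K : comNzRingType) S (a : K) :
  (wmatch (fun=> 'X) S).[a] = wmatch (fun=> a) S.
Proof.
rewrite /wmatch horner_sum; apply: eq_bigr => M _.
rewrite hornerM horner_prod; congr (_ * _); last first.
  by apply: eq_bigr => z _; rewrite hornerX.
by rewrite horner_exp hornerN hornerC.
Qed.

Lemma match_polyE (K : comNzRingType) S : match_poly e K S = wmatch (fun=> 'X) S.
Proof.
have cM M : is_matching e S M -> #|S :\: cover M| = (#|S| - 2 * #|M|)%N.
  by move=> mM; rewrite cardsDS ?cover_matching // (card_cover_matching mM).
have rM M : is_matching e S M -> (#|M| < (#|S| %/ 2).+1)%N.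
  move=> mM; have := subset_leq_card (cover_matching mM).
  rewrite (card_cover_matching mM); lia.
(* Matchings are grouped by size; [rM] makes [inord] faithful on these sizes. *)
rewrite /wmatch (partition_big (fun M => inord #|M| : 'I_(#|S| %/ 2).+1) xpredT) //=.
apply: eq_bigr => r _; rewrite /nmatch.
rewrite (eq_bigr (fun=> (-1) ^+ r * 'X^(#|S| - 2 * r))); last first.
  move=> M /andP[mM /eqP <-]; rewrite inordK ?rM //.
  by rewrite prodr_const cM.
rewrite sumr_const -[RHS]mulr_natr.
rewrite -mul_polyC polyCM rmorphXn rmorphN rmorph1 /= mulrAC; congr (_ * _).
rewrite polyC_natr; congr _%:R.
apply: eq_card => M; rewrite !inE unfold_in.
apply: andb_id2l => mM.
by rewrite -val_eqE /= inordK ?rM.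
Qed.

(** A matching with k uncovered vertices has derivative k X^(k-1) up to sign, one copy per uncovered
    vertex; exchanging the sums collects the copies by vertex. *)
Lemma deriv_wmatchX (K : comNzRingType) S :
  (wmatch (fun=> 'X : {poly K}) S)^`() = \sum_(v in S) wmatch (fun=> 'X) (S :\ v).
Proof.
rewrite {1}/wmatch raddf_sum /=.
transitivity (\sum_(v in S) \sum_(M | is_matching e S M && (v \notin cover M))
    (-1) ^+ #|M| * \prod_(z in (S :\ v) :\: cover M) ('X : {poly K})); last first.
  apply: eq_bigr => v _; apply: eq_bigl => M; by rewrite is_matchingD1.
rewrite (exchange_big_dep (is_matching e S)) /=; last by move=> v M _ /andP[].
apply: eq_bigr => M mM; rewrite mM prodr_const derivM.
have -> : ((-1) ^+ #|M| : {poly K})^`() = 0.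
  by rewrite -[-1]opprK; rewrite -(rmorph1 polyC) opprK -rmorphN -rmorphXn derivC.
rewrite mul0r add0r derivXn /=.
rewrite (eq_bigr (fun=> (-1) ^+ #|M| * 'X^(#|S :\: cover M|.-1))); last first.
  move=> v /andP[vS vM]; rewrite prodr_const; congr (_ * 'X^_).
  rewrite [in RHS](cardsD1 v) !inE vS vM /=.
  by apply: eq_card => z; rewrite !inE andbCA.
rewrite sumr_const mulrnAr; congr (_ *+ _).
by apply: eq_card => z; rewrite !inE andbC.
Qed.

End WeightedMatchingPolynomial.

(** * Rayleigh inequality *)

Section Rayleigh.
Variables (T : finType) (e : rel T).
Hypotheses (e_sym : symmetric e) (e_irr : irreflexive e).
Implicit Types (S : {set T}) (u v w z : T).

(* On the diagonal this is the convention that makes [rayleigh_rec] hold without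
   boundary term: unfolding it writes the gap as the Heilmann-Lieb sum of squares
   over all paths from [u] to [v]. *)
Definition rayleigh (K : comNzRingType) (y : T -> K) S u v : K :=
  if u == v then wmatch e y (S :\ v) ^+ 2 else
  wmatch e y (S :\ u) * wmatch e y (S :\ v) -
  wmatch e y S * wmatch e y (S :\ u :\ v).

(** After expanding [S] and [S :\ v] at [u], the terms containing [y u] cancel; a neighbour [z]
    other than [v] leaves a gap in [S :\ u], and [z = v] leaves a square. *)
Lemma rayleigh_rec (K : comNzRingType) (y : T -> K) S u v :
    u \in S -> v \in S -> u != v ->
  rayleigh y S u v = \sum_(z in S :\ u | e u z) rayleigh y (S :\ u) z v.
Proof.
move=> uS vS uv; rewrite /rayleigh (negPf uv).
rewrite (@wmatch_rec _ e e_sym e_irr _ y S u) //.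
rewrite (@wmatch_rec _ e e_sym e_irr _ y (S :\ v) u) ?inE ?uv //.
rewrite (setD1AC S v u).
(* A zero entry at [z = v] lets both expansions run over the same neighbours. *)
have -> : \sum_(z in S :\ u :\ v | e u z) wmatch e y (S :\ u :\ v :\ z) =
          \sum_(z in S :\ u | e u z)
             (if z == v then 0 else wmatch e y (S :\ u :\ v :\ z)).
  rewrite [RHS](bigID (fun z => z == v)) /= [X in _ = X + _]big1 ?add0r; last first.
    by move=> z /andP[_ ->].
  apply: eq_big => [z|z].
    by rewrite in_setD1 -andbA andbC.
  by rewrite !inE => /andP[/andP[/negPf->]].
transitivity (\sum_(z in S :\ u | e u z)
   (wmatch e y (S :\ u :\ z) * wmatch e y (S :\ u :\ v) -
    wmatch e y (S :\ u) * (if z == v then 0 else wmatch e y (S :\ u :\ v :\ z)))).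
  rewrite sumrB -big_distrl -big_distrr /=; ring.
apply: eq_bigr => z _; case: eqP => [->|_]; first by rewrite mulr0 subr0.
by rewrite (setD1AC (S :\ u) z v).
Qed.

Lemma rayleigh_ge0 (K : realDomainType) (y : T -> K) S u v :
  u \in S -> v \in S -> 0 <= rayleigh y S u v.
Proof.
have [n] := ubnP #|S|; elim: n S u => // n IHn S u ltS uS vS.
have [->|uv] := eqVneq u v; first by rewrite /rayleigh eqxx sqr_ge0.
rewrite rayleigh_rec //; apply: sumr_ge0 => z /andP[zS _].
apply: IHn => //; last by rewrite !inE eq_sym uv.
by rewrite -ltnS (leq_ltn_trans _ ltS) // (cardsD1 u S) uS.
Qed.

(** The neighbour [v] of [u] contributes exactly this square to [rayleigh_rec]; the other summands
    are nonnegative. *)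
Lemma sqr_le_rayleigh (K : realDomainType) (y : T -> K) S u v :
    u \in S -> v \in S -> e u v ->
  wmatch e y (S :\ u :\ v) ^+ 2 <= rayleigh y S u v.
Proof.
move=> uS vS euv; have vu := e_neq e_irr euv.
have vSu : v \in S :\ u by rewrite !inE vu.
rewrite rayleigh_rec // 1?eq_sym // (bigD1 v) ?vSu //= {1}/rayleigh eqxx.
by rewrite lerDl sumr_ge0 // => z /andP[/andP[zS _] _]; apply: rayleigh_ge0.
Qed.

(** The weight of [w] occurs only in the first term of the recurrence at [w], hence affinely. *)
Lemma wmatch_shift (K : comNzRingType) (a s : K) S w : w \in S ->
  wmatch e (fun z => if z == w then a + s else a) S =
  wmatch e (fun=> a) S + s * wmatch e (fun=> a) (S :\ w).
Proof.
move=> wS; rewrite !(@wmatch_rec _ e e_sym e_irr _ _ S w) // eqxx.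
have ext (A : {set T}) : w \notin A ->
    wmatch e (fun z => if z == w then a + s else a) A = wmatch e (fun=> a) A.
  by move=> wA; apply: eq_wmatch => z zA; case: eqP => // zw; rewrite -zw zA in wA.
rewrite ext ?inE ?eqxx // (eq_bigr (fun v => wmatch e (fun=> a) (S :\ w :\ v))).
  by rewrite mulrDl addrAC.
by move=> v _; rewrite ext // !inE eqxx andbF.
Qed.

Lemma discr_le0 (K : realFieldType) (a b c : K) :
  0 <= c -> (forall s, 0 <= a + b * s + c * s ^+ 2) -> b ^+ 2 <= 4 * a * c.
Proof.
move=> c0 pos; have [c_eq0|cN0] := eqVneq c 0.
  have [->|bN0] := eqVneq b 0; first by rewrite c_eq0 mulr0 expr0n.
  (* At this point the affine function takes the value -1. *)
  have := pos (- (a + 1) / b); rewrite c_eq0 mul0r addr0 mulrC divfK //.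
  by rewrite opprD addNKr ler0N1.
have c_gt0 : 0 < c by rewrite lt_neqAle eq_sym cN0.
(* The minimum of the quadratic. *)
have := pos (- b / (2 * c)).
have -> : a + b * (- b / (2 * c)) + c * (- b / (2 * c)) ^+ 2 =
          (4 * a * c - b ^+ 2) / (4 * c) by field.
by rewrite pmulr_lge0 ?subr_ge0 // invr_gt0 mulr_gt0.
Qed.

(** * Rayleigh gaps and Wronskians as polynomials *)

Section MatchPoly.
Variable R : rcfType.
Local Notation mu := (match_poly e R).

Definition rayleigh_poly S u v : {poly R} :=
  mu (S :\ u) * mu (S :\ v) - mu S * mu (S :\ u :\ v).

Definition wronskian S u : {poly R} :=
  mu (S :\ u) * (mu S)^`() - mu S * (mu (S :\ u))^`().

Lemma rayleigh_polyE S u v a : u != v ->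
  (rayleigh_poly S u v).[a] = rayleigh (fun=> a) S u v.
Proof.
move=> uv; rewrite /rayleigh (negPf uv) /rayleigh_poly !match_polyE //.
by rewrite !hornerE !horner_wmatchX.
Qed.

Lemma rayleigh_poly_ge0 S u v a : u \in S -> v \in S -> u != v ->
  0 <= (rayleigh_poly S u v).[a].
Proof. by move=> uS vS uv; rewrite rayleigh_polyE // rayleigh_ge0. Qed.

Lemma sqr_le_rayleigh_poly S u v a : u \in S -> v \in S -> e u v ->
  (mu (S :\ u :\ v) ^+ 2).[a] <= (rayleigh_poly S u v).[a].
Proof.
move=> uS vS euv; rewrite rayleigh_polyE 1?eq_sym ?(e_neq e_irr euv) //.
rewrite hornerE match_polyE // horner_wmatchX; exact: sqr_le_rayleigh.
Qed.

Lemma deriv_match_poly S : (mu S)^`() = \sum_(v in S) mu (S :\ v).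
Proof.
rewrite match_polyE // deriv_wmatchX; apply: eq_bigr => v _; by rewrite match_polyE.
Qed.

(** Both derivatives are sums over vertex deletions; pairing the terms that delete the same [v]
    yields the gap at [u], [v], and the unpaired [v = u] yields the square. *)
Lemma wronskianE S u : u \in S ->
  wronskian S u = mu (S :\ u) ^+ 2 + \sum_(v in S :\ u) rayleigh_poly S u v.
Proof.
move=> uS; rewrite /wronskian !deriv_match_poly (bigD1 u) //= sumrB.
rewrite -!big_distrr /= (eq_bigl (fun v => v \in S :\ u)); first by ring.
by move=> v; rewrite !inE andbC.
Qed.

Lemma sqr_le_wronskian S u a : u \in S ->
  (mu (S :\ u) ^+ 2).[a] <= (wronskian S u).[a].
Proof.
move=> uS; rewrite wronskianE // hornerD horner_sum lerDl sumr_ge0 // => v.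
by rewrite !inE => /andP[vu vS]; rewrite rayleigh_poly_ge0 // eq_sym.
Qed.

Lemma rayleigh_le_wronskian S u v a : u \in S -> v \in S -> u != v ->
  (rayleigh_poly S u v).[a] <= (wronskian S u).[a].
Proof.
move=> uS vS uv; rewrite wronskianE // [leRHS]hornerD horner_sum.
rewrite (bigD1 v) ?inE 1?eq_sym ?uv //= addrCA lerDl addr_ge0 //.
  by rewrite horner_exp sqr_ge0.
apply: sumr_ge0 => z; rewrite !inE => /andP[/andP[zu zS] _].
by rewrite rayleigh_poly_ge0 // eq_sym.
Qed.

(* The Rayleigh gap at [u], [v] with the weight of [w] shifted by [s] is quadratic
   in [s]; being nonnegative, it has nonpositive discriminant. *)
Lemma rayleigh_discr S u v w a : u \in S -> v \in S -> w \in S ->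
    u != v -> u != w -> v != w ->
  ((mu (S :\ u) * mu (S :\ v :\ w) + mu (S :\ v) * mu (S :\ u :\ w)
    - mu S * mu (S :\ u :\ v :\ w) - mu (S :\ w) * mu (S :\ u :\ v)) ^+ 2).[a] <=
  (4 *: (rayleigh_poly S u v * rayleigh_poly (S :\ w) u v)).[a].
Proof.
move=> uS vS wS uv uw vw; rewrite horner_exp hornerZ hornerM mulrA.
apply: discr_le0 => [|s]; first by rewrite rayleigh_poly_ge0 ?inE ?uw ?vw.
have := @rayleigh_ge0 _ (fun z => if z == w then a + s else a) S u v uS vS.
have [wu wv] : w != u /\ w != v by rewrite ![w == _]eq_sym.
rewrite /rayleigh (negPf uv) !wmatch_shift ?inE ?wu ?wv ?wS //.
rewrite /rayleigh_poly !match_polyE // !(hornerD, hornerN, hornerM) !horner_wmatchX.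
rewrite (setD1AC S w u) (setD1AC S w v) (setD1AC (S :\ u) w v).
congr (0 <= _); ring.
Qed.

(** Only the empty matching contributes in degree [#|S|], with coefficient 1. *)
Lemma match_poly_neq0 S : mu S != 0.
Proof.
have nm0 : nmatch e S 0 = 1%N.
  apply/eqP/cards1P; exists set0; apply/setP => M; rewrite !inE cards_eq0.
  case: eqP => [->|]; rewrite ?andbF // andbT /is_matching sub0set.
  by apply/trivIsetP => A B; rewrite inE.
apply/eqP => /(congr1 (fun p : {poly R} => p`_#|S|)) /eqP; rewrite coef0.
rewrite coef_sum big_ord_recl /= big1 => [|i _]; last first.
  rewrite coefZ coefXn; case: eqP; rewrite ?mulr0 //=.
  case: i => i /=; rewrite /bump /=; lia.
by rewrite coefZ coefXn muln0 subn0 eqxx nm0 expr0 !mulr1 addr0 oner_eq0.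
Qed.

End MatchPoly.
End Rayleigh.

(** * Orders of vanishing *)

Section OrderAt.
Variables (R : rcfType) (theta : R).
Implicit Types p q : {poly R}.
Local Notation t := ('X - theta%:P).

Lemma horner_right_ge0 p :
  (forall x, theta < x -> 0 <= p.[x]) -> 0 <= p.[theta].
Proof.
move=> pos; rewrite leNgt; apply/negP => p_lt0.
have /factor_theorem[q Dp] : root (p - p.[theta]%:P) theta.
  by rewrite /root !hornerE subrr.
have [b qb] := poly_itv_bound q theta (theta + 1).
(* On the unit interval right of [theta], [q] is bounded by [b]. The step [d] stays inside it, and
   [d * B < c] is too small an increment to lift [p] from [- c] to 0. *)
pose c := - p.[theta]; pose B := `|b| + 1; pose d := c / (c + B).
have c0 : 0 < c by rewrite oppr_gt0.
have B0 : 0 < B by rewrite ltr_wpDl.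
have cB0 : 0 < c + B by rewrite addr_gt0.
have d0 : 0 < d by rewrite divr_gt0.
have d1 : d <= 1 by rewrite ler_pdivrMr // mul1r lerDl ltW.
have dB : d * B < c.
  by rewrite /d mulrAC ltr_pdivrMr // ltr_pM2l // ltrDr.
have := pos (theta + d); rewrite ltrDl d0 => /(_ isT); apply/negP; rewrite -ltNge.
have -> : p.[theta + d] = q.[theta + d] * d - c.
  rewrite -[p](subrK p.[theta]%:P) Dp !(hornerD, hornerM, hornerN, hornerX, hornerC) /c.
  by ring.
rewrite subr_lt0; apply: le_lt_trans dB; rewrite mulrC ler_pM2l //.
apply: le_trans (ler_norm _) (le_trans (qb _ _) _).
  by rewrite lerDl ltW //= lerD2l.
by rewrite (le_trans (ler_norm b)) // lerDl.
Qed.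

Lemma mup_factor p : p != 0 ->
  exists2 q, q.[theta] != 0 & p = q * t ^+ mup theta p.
Proof.
move=> p0; have [m [q]] := multiplicity_XsubC p theta; rewrite p0 => nq Dp.
by exists q => //; rewrite {2}Dp mupMr // mup_XsubCX eqxx.
Qed.

(** If the order [i] of [p] were below [k], dividing by [t ^+ i], which is positive right of
    [theta], and approaching [theta] would trap the cofactor of [p] between 0 and 0. *)
Lemma dvdp_squeeze p q k : (forall x, 0 <= p.[x]) -> (forall x, p.[x] <= q.[x]) ->
  t ^+ k %| q -> t ^+ k %| p.
Proof.
move=> p_ge0 le_pq /dvdpP[q1 Dq].
have [->|p0] := eqVneq p 0; first by rewrite dvdp0.
have [p1 p1N0 Dp] := mup_factor p0; rewrite -mup_geq // leqNgt.
set i := mup _ _ in Dp *; apply/negP => lt_ik.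
case/negP: p1N0; rewrite eq_le.
have tE (x : R) n : (t ^+ n).[x] = (x - theta) ^+ n.
  by rewrite horner_exp hornerXsubC.
have t_gt0 x n : theta < x -> 0 < (x - theta) ^+ n.
  by move=> ltx; rewrite exprn_gt0 // subr_gt0.
apply/andP; split; last first.
  apply: horner_right_ge0 => x ltx.
  by have := p_ge0 x; rewrite Dp hornerM tE pmulr_lge0 ?t_gt0.
have : 0 <= (q1 * t ^+ (k - i) - p1).[theta].
  apply: horner_right_ge0 => x ltx; rewrite -(pmulr_lge0 _ (t_gt0 x i ltx)).
  rewrite !(hornerD, hornerN, hornerM) tE mulrBl -mulrA -exprD subnK 1?ltnW //.
  by rewrite subr_ge0; have := le_pq x; rewrite Dp Dq !hornerM !tE.
rewrite !(hornerD, hornerN, hornerM) tE subrr expr0n subn_eq0 leqNgt lt_ik mulr0.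
by rewrite add0r oppr_ge0.
Qed.

(** The order of a square is even, so an odd bound rounds up; the multiplicity arguments rely on
    this gain. *)
Lemma dvdp_sqr_uphalf p k : t ^+ k %| p ^+ 2 -> t ^+ uphalf k %| p.
Proof.
have [->|p0] := eqVneq p 0; first by rewrite dvdp0.
rewrite -!mup_geq ?expf_neq0 // expr2 mupM //; lia.
Qed.

Lemma dvdp_deriv p k : t ^+ k %| p -> t ^+ k.-1 %| p^`().
Proof.
case: k => [|k]; first by rewrite /= expr0 !dvd1p.
case/dvdpP=> q ->; rewrite derivM deriv_exp derivXsubC mul1r /=.
rewrite dvdp_add //; first by rewrite exprS !dvdp_mull.
by rewrite -mulr_natr dvdp_mull // dvdp_mulr.
Qed.

(** The terms differentiating the common factor cancel, so no order is lost to the derivative. *)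
Lemma dvdp_wronskian p q k : t ^+ k %| p -> t ^+ k %| q ->
  t ^+ (k + k) %| q * p^`() - p * q^`().
Proof.
case/dvdpP=> p1 -> /dvdpP[q1 ->]; rewrite !derivM exprD.
by apply/dvdpP; exists (q1 * p1^`() - p1 * q1^`()); ring.
Qed.

Lemma mup_deriv p : p != 0 -> (0 < mup theta p)%N ->
  ~~ (t ^+ mup theta p %| p^`()).
Proof.
move=> p0; have [q qN0] := mup_factor p0; set m := mup _ _ => Dp m0.
rewrite Dp derivM dvdp_addr; last by rewrite dvdp_mull.
rewrite deriv_exp derivXsubC mul1r.
rewrite -{1}(prednK m0) exprS mulrnAr -mulrnAl.
rewrite dvdp_mul2r ?expf_neq0 ?polyXsubC_eq0 // dvdp_XsubCl /root hornerMn.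
by rewrite mulrn_eq0 negb_or -lt0n m0.
Qed.

End OrderAt.

(** * Multiplicities of matching polynomials *)

Section Multiplicity.
Variables (T : finType) (e : rel T).
Hypotheses (e_sym : symmetric e) (e_irr : irreflexive e).
Variables (R : rcfType) (theta : R).
Implicit Types (S C X : {set T}) (u v w z : T).
Local Notation mu := (match_poly e R).
Local Notation t := ('X - theta%:P).
Local Notation m := (mult e theta).
Local Notation neq0 := (match_poly_neq0 e R).

Lemma mult_geq S k : (k <= m S)%N = (t ^+ k %| mu S).
Proof. by rewrite mup_geq ?neq0. Qed.

Lemma mult_geqM (A B : {set T}) k : (t ^+ k %| mu A * mu B) = (k <= m A + m B)%N.
Proof. by rewrite -mup_geq ?mulf_neq0 ?neq0 // mupM ?neq0. Qed.

Lemma dvdp_rayleigh S u v k :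
  (k <= m (S :\ u) + m (S :\ v))%N -> (k <= m S + m (S :\ u :\ v))%N ->
  t ^+ k %| rayleigh_poly e R S u v.
Proof. by move=> k1 k2; rewrite dvdp_sub ?mult_geqM. Qed.

Lemma mult_dvd S : t ^+ m S %| mu S.
Proof. by rewrite -mult_geq. Qed.

Lemma setD1_notin S u : u \notin S -> S :\ u = S.
Proof. by move=> uS; apply/setDidPl; rewrite disjoint_sym disjoints1. Qed.

(** The Wronskian has order at least [m S + m (S :\ u) - 1] and dominates the square of
    [mu (S :\ u)]; halving with rounding up gives the bound. *)
Lemma mult_le_D1 S u : (m S <= (m (S :\ u)).+1)%N.
Proof.
have [uS|uS] := boolP (u \in S); last by rewrite setD1_notin.
have [-> //|mS0] := posnP (m S).
have : t ^+ (m S + m (S :\ u)).-1 %| wronskian e R S u.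
  apply: dvdp_sub.
    apply: dvdp_trans (dvdp_mul (mult_dvd _) (dvdp_deriv (mult_dvd S))).
    by rewrite -exprD dvdp_exp2l //; lia.
  apply: dvdp_trans (dvdp_mul (mult_dvd S) (dvdp_deriv (mult_dvd _))).
  by rewrite -exprD dvdp_exp2l //; lia.
move=> /(@dvdp_squeeze _ _ (mu (S :\ u) ^+ 2)) dW.
have {dW}/dvdp_sqr_uphalf : t ^+ (m S + m (S :\ u)).-1 %| mu (S :\ u) ^+ 2.
  apply: dW => x; first by rewrite horner_exp sqr_ge0.
  exact: sqr_le_wronskian.
by rewrite -mult_geq; lia.
Qed.

(** In the recurrence at [u] every term has order at least [m (S :\ u) - 1], by [mult_le_D1] applied
    to [S :\ u]. *)
Lemma multD1_le S u : (m (S :\ u) <= (m S).+1)%N.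
Proof.
have [uS|uS] := boolP (u \in S); last by rewrite setD1_notin.
suff: ((m (S :\ u)).-1 <= m S)%N by lia.
rewrite mult_geq match_polyE // (@wmatch_rec _ e e_sym e_irr _ _ S u) // -match_polyE //.
rewrite dvdp_sub ?dvdp_mull -?mult_geq ?leq_pred //.
apply: (big_ind (fun p => _ %| p)) => [|p q|v _]; rewrite ?dvdp0 //.
  exact: dvdp_add.
by rewrite -match_polyE // -mult_geq; have := mult_le_D1 (S :\ u) v; lia.
Qed.

Lemma multD_le S X : (m (S :\: X) <= m S + #|X|)%N.
Proof.
have [n] := ubnP #|X|; elim: n X => // n IHn X ltX.
have [->|[u uX]] := set_0Vmem X; first by rewrite setD0 leq_addr.
have cX := cardsD1 u X; rewrite uX in cX.
have -> : S :\: X = (S :\: (X :\ u)) :\ u by rewrite setDDl setUC setD1K.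
have := multD1_le (S :\: (X :\ u)) u; have := IHn (X :\ u); lia.
Qed.

(** Otherwise every [mu (S :\ v)], and so their sum, the derivative of [mu S], would vanish to order
    [m S]. *)
Lemma exists_essential S : (0 < m S)%N -> exists2 u, u \in S & essential e theta S u.
Proof.
move=> m0; apply/exists_inP; apply: contraLR (mup_deriv (neq0 S) m0) => /exists_inPn nE.
rewrite negbK deriv_match_poly //.
apply: (big_ind (fun p => _ %| p)) => [|p q|v]; rewrite ?dvdp0 //; first exact: dvdp_add.
rewrite -mult_geq -/(m S) => /nE; rewrite /essential.
by have := mult_le_D1 S v; lia.
Qed.

(* If [u] were neutral, the Wronskian and hence the smaller Rayleigh gap at [u], [v]
   would vanish to order [2 m S], whereas the gap has order [2 m S - 1]. *)
Lemma special_positive S u v : u \in S -> v \in S -> e u v ->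
    essential e theta S v -> ~~ essential e theta S u ->
  m (S :\ u) = (m S).+1.
Proof.
move=> uS vS euv /eqP ev nu; apply/eqP; apply: contraT => npos.
have uv : u != v by rewrite eq_sym (e_neq e_irr euv).
have mu_ : m (S :\ u) = m S.
  by move: nu npos (mult_le_D1 S u) (multD1_le S u); rewrite /essential; lia.
have dW : t ^+ (m S + m S) %| rayleigh_poly e R S u v.
  apply: (@dvdp_squeeze _ _ _ (wronskian e R S u)) => [x|x|].
  - exact: rayleigh_poly_ge0.
  - exact: rayleigh_le_wronskian.
  - by apply: dvdp_wronskian; rewrite -mult_geq // mu_.
have /dvdp_sqr_uphalf : t ^+ (m S + m S) %| mu (S :\ u :\ v) ^+ 2.
  apply: dvdp_squeeze dW => x; first by rewrite horner_exp sqr_ge0.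
  exact: sqr_le_rayleigh_poly.
rewrite -mult_geq => muv.
have : t ^+ (m S + m S) %| mu (S :\ u) * mu (S :\ v).
  rewrite -(subrK (mu S * mu (S :\ u :\ v)) (mu (S :\ u) * _)).
  by rewrite dvdp_add // mult_geqM; lia.
by rewrite mult_geqM; lia.
Qed.

Lemma dvdp_rayleigh_cross S u v w k : u \in S -> v \in S -> w \in S ->
    u != v -> u != w -> v != w ->
  t ^+ k %| rayleigh_poly e R S u v * rayleigh_poly e R (S :\ w) u v ->
  t ^+ uphalf k %| mu (S :\ u) * mu (S :\ v :\ w) + mu (S :\ v) * mu (S :\ u :\ w)
    - mu S * mu (S :\ u :\ v :\ w) - mu (S :\ w) * mu (S :\ u :\ v).
Proof.
move=> uS vS wS uv uw vw dAC; apply: dvdp_sqr_uphalf.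
apply: dvdp_squeeze; first by move=> x; rewrite horner_exp sqr_ge0.
  by move=> x; apply: rayleigh_discr.
by rewrite dvdpZr // pnatr_eq0.
Qed.

(** Were the multiplicity [h] after three deletions below [m S + 3], the product
    [mu S * mu (S :\ u :\ v :\ w)], of order [m S + h], would be the only term of the cross
    expression of order below [m S + h + 1], against the discriminant bound. *)
Lemma mult_triple S u v w : u \in S -> v \in S -> w \in S ->
    u != v -> u != w -> v != w ->
    m (S :\ u :\ v) = (m S + 2)%N -> m (S :\ u :\ w) = (m S + 2)%N ->
    m (S :\ v :\ w) = (m S + 2)%N ->
  m (S :\ u :\ v :\ w) = (m S + 3)%N.
Proof.
move=> uS vS wS uv uw vw muv muw mvw.
have mu1 : m (S :\ u) = (m S).+1.
  by have := multD1_le S u; have := multD1_le (S :\ u) v; lia.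
have mv1 : m (S :\ v) = (m S).+1.
  by have := multD1_le S v; have := multD1_le (S :\ v) w; lia.
have mw1 : m (S :\ w) = (m S).+1.
  by have := multD1_le S w; have := multD1_le (S :\ w) u; rewrite (setD1AC S w u); lia.
have := multD1_le (S :\ u :\ v) w; have := mult_le_D1 (S :\ u :\ v) w.
have [h hE] : exists h, h = m (S :\ u :\ v :\ w) by eexists.
rewrite -hE => h1 h2.
have [//|h3] : (h = m S + 3)%N \/ (h < m S + 3)%N by lia.
have dA : t ^+ (2 * m S + 2) %| rayleigh_poly e R S u v by apply: dvdp_rayleigh; lia.
have dC : t ^+ (m S + 1 + h) %| rayleigh_poly e R (S :\ w) u v.
  by apply: dvdp_rayleigh; rewrite ?(setD1AC S w u) ?(setD1AC S w v)
       ?(setD1AC (S :\ u) w v); lia.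
(* The gaps have total order at least [3 * m S + 3 + h]; half of this, rounded up, exceeds [m S + h]
   because [h <= m S + 2]. *)
have := dvdp_mul dA dC; rewrite -exprD => /dvdp_rayleigh_cross-/(_ uS vS wS uv uw vw).
move=> /(dvdp_trans (dvdp_exp2l t (_ : (m S + h).+1 <= _)%N)) dB.
have {}dB := dB ltac:(lia).
suff: t ^+ (m S + h).+1 %| mu S * mu (S :\ u :\ v :\ w) by rewrite mult_geqM; lia.
move: dB; rewrite addrAC dvdp_addr; first by rewrite dvdpNr.
by rewrite dvdp_sub ?dvdp_add ?mult_geqM; lia.
Qed.

(** If the conclusion failed, [mu (S :\ v) * mu (S :\ u :\ w)] would have order [2 * m S - 3] and
    the other three cross terms at least [2 * m S - 2], so the cross expression could not reach the
    order forced by the discriminant. *)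
Lemma gallai_trans S u v w : u \in S -> v \in S -> w \in S ->
    u != v -> u != w -> v != w ->
    essential e theta S u -> essential e theta S v -> essential e theta S w ->
    (m (S :\ u) <= m (S :\ u :\ v))%N -> (m (S :\ w) <= m (S :\ w :\ v))%N ->
  (m (S :\ u) <= m (S :\ u :\ w))%N.
Proof.
move=> uS vS wS uv uw vw /eqP eu /eqP ev /eqP ew muv mwv.
rewrite leqNgt; apply/negP => muw.
have muw1 := mult_le_D1 (S :\ u) w; have mH := mult_le_D1 (S :\ u :\ v) w.
rewrite (setD1AC S w v) in mwv.
have dA : t ^+ (2 * m S - 2) %| rayleigh_poly e R S u v by apply: dvdp_rayleigh; lia.
have dC : t ^+ (2 * m S - 3) %| rayleigh_poly e R (S :\ w) u v.
  by apply: dvdp_rayleigh; rewrite ?(setD1AC S w u) ?(setD1AC S w v)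
       ?(setD1AC (S :\ u) w v); lia.
(* The total order [4 * m S - 5] is odd; rounding its half up gives [2 * m S - 2]. *)
have := dvdp_mul dA dC; rewrite -exprD => /dvdp_rayleigh_cross-/(_ uS vS wS uv uw vw).
move=> /(dvdp_trans (dvdp_exp2l t (_ : 2 * m S - 2 <= _)%N)) dB.
have {}dB := dB ltac:(lia).
suff: t ^+ (2 * m S - 2) %| mu (S :\ v) * mu (S :\ u :\ w) by rewrite mult_geqM; lia.
move: dB; rewrite -!addrA dvdp_addr; last by rewrite mult_geqM; lia.
rewrite dvdp_addl //; by rewrite dvdp_add ?dvdpNr ?mult_geqM; lia.
Qed.

End Multiplicity.

(** * Critical components *)

Section CriticalComponents.
Variables (T : finType) (e : rel T).
Hypotheses (e_sym : symmetric e) (e_irr : irreflexive e).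
Variables (R : rcfType) (theta : R).
Implicit Types (S C X Y : {set T}) (u v w z : T).
Local Notation m := (mult e theta).

Lemma connect_invariant (r : rel T) (P : T -> Prop) :
    (forall x y, r x y -> P x -> P y) ->
  forall x y, connect r x y -> P x -> P y.
Proof.
move=> stepP x y /connectP[p]; elim: p x => [|z p IHp] x /= => [_ -> //|].
by case/andP=> rxz pth eqy Px; apply: (IHp z) => //; apply: stepP Px.
Qed.

(** Adjacency puts the square of [mu (S :\ u :\ v)] below the gap, which has order at least
    [2 * m S - 2]. This is the one-edge case from which [gallai_trans] propagates. *)
Lemma essential_adj S u v : u \in S -> v \in S -> e u v ->
    essential e theta S u -> essential e theta S v ->
  (m (S :\ u) <= m (S :\ u :\ v))%N.
Proof.
move=> uS vS euv /eqP eu /eqP ev.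
have muv := mult_le_D1 e_sym e_irr theta (S :\ u) v.
have dW : ('X - theta%:P) ^+ (2 * m S - 2) %| rayleigh_poly e R S u v.
  by apply: dvdp_rayleigh; lia.
have /dvdp_sqr_uphalf : ('X - theta%:P) ^+ (2 * m S - 2) %|
    match_poly e R (S :\ u :\ v) ^+ 2.
  apply: dvdp_squeeze dW => x; first by rewrite horner_exp sqr_ge0.
  exact: sqr_le_rayleigh_poly.
by rewrite -mult_geq; lia.
Qed.

(** Gallai's lemma: along paths from [u], no vertex of [C :\ u] is essential there, so [C :\ u] has
    multiplicity 0 by [exists_essential]. *)
Lemma critical_mult1 C : critical e theta C -> m C = 1%N.
Proof.
case/andP=> /andP[/set0Pn[u uC] /forall_inP conC] /forall_inP essC.
have le_uv v : v \in C -> v != u -> (m (C :\ u) <= m (C :\ u :\ v))%N.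
  move=> vC vu.
  (* Paths start at [u] and may return to it, where [gallai_trans] does not apply; hence the extra
     disjunct. *)
  suff : v == u \/ (m (C :\ u) <= m (C :\ u :\ v))%N by rewrite (negPf vu) => -[].
  have /forall_inP/(_ v vC) uv := conC u uC.
  apply: (connect_invariant (r := adjS e C) (P := fun v =>
      v == u \/ (m (C :\ u) <= m (C :\ u :\ v))%N) _ uv); last by left.
  move=> x y /and3P[xC yC exy] Px.
  have [|yu] := eqVneq y u; [by left | right].
  have eyx : e y x by rewrite e_sym.
  case: (eqVneq x u) Px => [xu _|xu [//|Px]].
    by rewrite -xu; apply: essential_adj; rewrite ?essC.
  apply: (@gallai_trans _ _ e_sym e_irr _ _ _ _ x) => //; rewrite ?essC // 1?eq_sym //.
    exact: e_neq exy.
  by apply: essential_adj; rewrite ?essC.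
have /eqP <- := essC u uC; congr _.+1.
apply/eqP; rewrite -leqn0 leqNgt; apply/negP => /(exists_essential e_sym e_irr)[v].
rewrite !inE => /andP[vu vC] /eqP ev.
by have := le_uv v vC vu; rewrite -ev ltnn.
Qed.

Lemma multU (A B : {set T}) : [disjoint A & B] ->
  {in A & B, forall a b, ~~ e a b} -> m (A :|: B) = (m A + m B)%N.
Proof.
move=> dAB nAB.
rewrite /mult -mupM ?match_poly_neq0 // !match_polyE // wmatchU //.
Qed.

Lemma mult0 : m set0 = 0%N.
Proof. by rewrite /mult match_polyE // wmatch0 mupNroot // root1. Qed.

Lemma mult_cover (P : {set {set T}}) : trivIset P ->
    {in P &, forall A B : {set T}, A != B -> {in A & B, forall a b, ~~ e a b}} ->
  m (cover P) = (\sum_(C in P) m C)%N.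
Proof.
have [n] := ubnP #|P|; elim: n P => // n IHn P ltP tP nP.
have [->|[C CP]] := set_0Vmem P; first by rewrite /cover !big_set0 mult0.
rewrite (bigD1 C) //= (eq_bigl (fun D => D \in P :\ C)); last first.
  by move=> D; rewrite !inE andbC.
rewrite -IHn; first last.
- by move=> A B /setD1P[_ AP] /setD1P[_ BP]; apply: nP.
- exact: trivIsetD.
- by move: ltP; rewrite (cardsD1 C) CP.
have sC : C \subset cover P by apply: (bigcup_max C).
have cE : cover (P :\ C) = cover P :\: C by rewrite coverD1.
rewrite -multU; first by rewrite cE setDE setUIr setUCr setIT (setUidPr sC).
  by rewrite cE disjoint_sym disjoints_subset subsetDr.
move=> a b aC /bigcupP[B /setD1P[BC BP] bB]; apply: (nP C B) => //.
by rewrite eq_sym.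
Qed.

(** * Connected components of induced subgraphs *)

Lemma adjS_sym S : symmetric (adjS e S).
Proof. by move=> x y; rewrite /adjS e_sym; case: (x \in S); case: (y \in S). Qed.

Lemma components_sub S C : C \in components e S -> C \subset S.
Proof. by case/imsetP=> x _ ->; apply/subsetP => y; rewrite inE => /andP[]. Qed.

Lemma componentsE S C z : C \in components e S -> z \in C ->
  C = [set y in S | connect (adjS e S) z y].
Proof.
case/imsetP=> x xS ->; rewrite inE => /andP[_ xz]; apply/setP => y.
by rewrite !inE (same_connect (sym_connect_sym (adjS_sym S)) xz).
Qed.

Lemma components_eq S C D a b : C \in components e S -> D \in components e S ->
  a \in C -> b \in D -> connect (adjS e S) a b -> C = D.
Proof.
move=> cC cD aC bD ab; rewrite (componentsE cC aC) (componentsE cD bD).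
by apply/setP => y; rewrite !inE (same_connect (sym_connect_sym (adjS_sym S)) ab).
Qed.

Lemma components_adj S C D a b : C \in components e S -> D \in components e S ->
  a \in C -> b \in D -> e a b -> C = D.
Proof.
move=> cC cD aC bD ab; apply: (components_eq cC cD aC bD); apply: connect1.
by rewrite /adjS ab (subsetP (components_sub cC)) // (subsetP (components_sub cD)).
Qed.

Lemma components_trivIset S : trivIset (components e S).
Proof.
apply/trivIsetP => C D cC cD; apply: contraNT => /pred0Pn[z /andP[zC zD]].
by apply/eqP; apply: (components_eq cC cD zC zD).
Qed.

Lemma cover_components S : cover (components e S) = S.
Proof.
apply/eqP; rewrite eqEsubset; apply/andP; split.
  by apply/bigcupsP => C; apply: components_sub.
apply/subsetP => x xS; apply/bigcupP.
by exists [set y in S | connect (adjS e S) x y]; rewrite ?imset_f // inE xS connect0.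
Qed.

Lemma components_nonadj S :
  {in components e S &, forall A B : {set T}, A != B ->
     {in A & B, forall a b, ~~ e a b}}.
Proof.
move=> A B cA cB nAB a b aA bB; apply: contra nAB => ab.
by apply/eqP; apply: (components_adj cA cB aA bB ab).
Qed.

Lemma components_connected S C : C \in components e S -> connectedS e C.
Proof.
move=> cC; apply/andP; split.
  case/imsetP: cC => x xS ->; apply/set0Pn; exists x; by rewrite inE xS connect0.
apply/forall_inP => a aC; apply/forall_inP => b bC.
have : connect (adjS e S) a b by move: bC; rewrite (componentsE cC aC) inE => /andP[].
have inv x y : adjS e S x y -> x \in C /\ connect (adjS e C) a x ->
    y \in C /\ connect (adjS e C) a y.
  move=> /[dup] Sxy /and3P[_ yS exy] [xC ax].
  have yC : y \in C by rewrite (componentsE cC xC) inE yS connect1.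
  by split=> //; apply: connect_trans ax (connect1 _); rewrite /adjS xC yC.
by move=> /(connect_invariant inv) -[//|_ ].
Qed.

Lemma mult_components S : m S = (\sum_(C in components e S) m C)%N.
Proof.
rewrite -[in LHS](cover_components S).
exact: mult_cover (components_trivIset S) (@components_nonadj S).
Qed.

Lemma ncritE S :
  ncrit e theta S = (\sum_(C in components e S) critical e theta C)%N.
Proof.
rewrite /ncrit -sum1_card (eq_bigl (fun C => (C \in components e S) && critical e theta C)).
  by rewrite big_mkcondr; apply: eq_bigr => C _; case: critical.
by move=> C; rewrite inE.
Qed.

(** By Gallai's lemma each critical component contributes exactly 1 to the sum of multiplicities. *)
Lemma ncrit_le_mult S : (ncrit e theta S <= m S)%N.
Proof.
rewrite ncritE mult_components; apply: leq_sum => C _.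
by case: (boolP (critical e theta C)) => // /critical_mult1 ->.
Qed.

Lemma multD1_component S C u : C \in components e S -> u \in C ->
  (m (S :\ u) + m C = m S + m (C :\ u))%N.
Proof.
move=> cC uC; have sCS := components_sub cC.
have uS := subsetP sCS u uC.
have nadj : {in C & S :\: C, forall a b, ~~ e a b}.
  move=> a b aC /setDP[bS bC]; apply: contra bC => ab.
  rewrite (componentsE cC aC) inE bS connect1 //.
  by rewrite /adjS (subsetP sCS) // bS.
have dis : [disjoint C & S :\: C].
  by rewrite disjoint_sym disjoints_subset subsetDr.
have -> : m S = (m C + m (S :\: C))%N.
  by rewrite -multU // setDE setUIr setUCr setIT (setUidPr sCS).
have -> : S :\ u = (C :\ u) :|: (S :\: C).
  apply/setP => z; rewrite !inE; case: eqP => [->|_]; first by rewrite uC.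
  by case: (boolP (z \in C)) => [/(subsetP sCS) ->|].
rewrite multU; first by lia.
  by apply: disjointWl dis; apply: subsetDl.
by move=> a b /setD1P[_ aC]; apply: nadj.
Qed.

(* Without positive vertices, essential vertices have only essential neighbours, so a
   component containing one is critical. *)
Lemma mult_eq_ncrit S : {in S, forall u, m (S :\ u) <= m S}%N ->
  m S = ncrit e theta S.
Proof.
move=> npos; rewrite ncritE mult_components; apply: eq_bigr => C cC.
have con := components_connected cC; have /andP[C0 /forall_inP conC] := con.
have nposC u : u \in C -> (m (C :\ u) <= m C)%N.
  move=> uC; have := npos u (subsetP (components_sub cC) u uC).
  by have := multD1_component cC uC; lia.
have [mC0|mC0] := posnP (m C).
  rewrite mC0; apply/esym/eqP; rewrite eqb0; apply/negP => /critical_mult1.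
  by rewrite mC0.
have [u uC eu] := exists_essential e_sym e_irr mC0.
suff crit : critical e theta C by rewrite crit critical_mult1.
rewrite /critical con; apply/forall_inP => v vC.
have /forall_inP/(_ v vC) uv := conC u uC.
apply: (connect_invariant (r := adjS e C)
          (P := fun v => essential e theta C v) _ uv) => //.
move=> x y /and3P[xC yC exy] ex; apply: contraT => ny.
have := nposC y yC; rewrite (@special_positive _ _ e_sym e_irr _ _ C y x) ?ltnn //.
by rewrite e_sym.
Qed.

(** * Tutte, extreme and nice sets *)

Lemma multC_le X : (m (~: X) <= m [set: T] + #|X|)%N.
Proof. by rewrite -setTD multD_le. Qed.

(** Each deletion gains at most 1, so a total gain of [#|X|] leaves no slack at any intermediate
    set. *)
Lemma extreme_sub X Y : Y \subset X -> extreme_set e theta X -> extreme_set e theta Y.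
Proof.
move=> sYX /eqP exX; apply/eqP.
have := multD_le e_sym e_irr theta (~: Y) (X :\: Y); have := multC_le Y.
have -> : ~: Y :\: (X :\: Y) = ~: X.
  apply/setP => z; rewrite !inE.
  by case: (boolP (z \in Y)) => [/(subsetP sYX) -> //|]; rewrite andbT.
by rewrite exX cardsDS //; have := subset_leq_card sYX; lia.
Qed.

Lemma tutte_extreme X : tutte_set e theta X -> extreme_set e theta X.
Proof.
move=> /eqP tX; apply/eqP.
by have := ncrit_le_mult (~: X); have := multC_le X; rewrite tX; lia.
Qed.

(** A vertex whose deletion raised the multiplicity of the complement could be added to [X];
    maximality excludes it, and [mult_eq_ncrit] applies. *)
Lemma maximal_extreme_tutte X :
  maximal_set (extreme_set e theta) X -> tutte_set e theta X.
Proof.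
case=> /[dup] exX /eqP mX maxX; rewrite /tutte_set -mult_eq_ncrit // => u.
rewrite inE => uX; have := maxX (u |: X) (properUr _); rewrite sub1set uX => /(_ isT).
rewrite /extreme_set cardsU1 uX -setC_D1 mX.
by have := multD1_le e_sym e_irr theta (~: X) u; lia.
Qed.

Lemma extreme_nice X : extreme_set e theta X -> nice_set e theta X.
Proof.
move=> exX; apply/forall_inP => u uX; apply/forall_inP => v vX.
apply/implyP => uv; have : extreme_set e theta [set u; v].
  by apply: extreme_sub exX; rewrite subUset !sub1set uX.
by rewrite /extreme_set cards2 uv.
Qed.

(** Induction deleting some [u] of [X] from both sets: by [mult_triple], pairs in [X :\ u] still
    gain 2 over [S :\ u]. *)
Lemma mult_pairwise S X : (1 < #|X|)%N -> X \subset S ->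
    {in X &, forall u v, u != v -> m (S :\ u :\ v) = m S + 2}%N ->
  m (S :\: X) = (m S + #|X|)%N.
Proof.
have [n] := ubnP #|X|; elim: n S X => // n IHn S X ltX gtX sXS pairX.
have [u uX] : exists u, u \in X by apply/card_gt0P; apply: ltnW.
have cX := cardsD1 u X; rewrite uX in cX.
have [v vXu] : exists v, v \in X :\ u by apply/card_gt0P; lia.
have [vu vX] := setD1P vXu; have uv : u != v by rewrite eq_sym.
have muv := pairX u v uX vX uv.
have mu1 : m (S :\ u) = (m S).+1.
  have := multD1_le e_sym e_irr theta S u.
  by have := multD1_le e_sym e_irr theta (S :\ u) v; lia.
have DX : S :\: X = (S :\ u) :\: (X :\ u) by rewrite setDDl setD1K.
(* The base case is a two-element [X], where the pair hypothesis is the claim. *)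
have [Xu1|Xu1] := leqP #|X :\ u| 1.
  have /eqP/cards1P[w Xw] : #|X :\ u| = 1%N by lia.
  by move: vXu; rewrite DX Xw inE => /eqP <-; lia.
rewrite DX IHn //; [by lia | by lia | exact: setSD |].
move=> w z /setD1P[wu wX] /setD1P[zu zX] wz.
rewrite mult_triple ?(subsetP sXS) ?pairX // 1?eq_sym //; lia.
Qed.

Lemma nice_extreme X : (1 < #|X|)%N -> nice_set e theta X -> extreme_set e theta X.
Proof.
move=> gtX /forall_inP niceX; rewrite /extreme_set -setTD mult_pairwise ?subsetT //.
move=> u v uX vX uv; have /forall_inP/(_ v vX)/implyP/(_ uv)/eqP <- := niceX u uX.
by congr m; rewrite setDDl setTD.
Qed.

Lemma maximal_set_sup (P : {set T} -> bool) X : P X ->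
  exists2 Y, maximal_set P Y & X \subset Y.
Proof.
move=> PX; have [Y /maxsetP[PY maxY] sXY] := @maxset_exists _ P X PX.
exists Y => //; split=> // Z /properP[sYZ [z zZ zY]].
by apply: contraNN zY => PZ; rewrite -(maxY Z PZ sYZ).
Qed.

End CriticalComponents.

Theorem theorem3p6 (T : finType) (e : rel T)
    (e_sym : symmetric e) (e_irr : irreflexive e)
    (R : rcfType) (theta : R) (X : {set T}) :
  (1 < #|X|)%N ->
  (maximal_set (tutte_set e theta) X <-> maximal_set (extreme_set e theta) X) /\
  (maximal_set (extreme_set e theta) X <-> maximal_set (nice_set e theta) X).
Proof.
move=> gtX; split; split.
(* A maximal extreme set above [X] is again Tutte, so it equals [X]. *)
- case=> tX maxX.
  have [Y maxY sXY] := maximal_set_sup (tutte_extreme e_sym e_irr tX).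
  have tY := maximal_extreme_tutte e_sym e_irr maxY.
  have [XY|nXY] := eqVneq X Y; first by rewrite XY.
  by have := maxX Y; rewrite properEneq nXY sXY tY => /(_ isT).
- move=> maxX; split=> [|Y XY]; first exact: maximal_extreme_tutte.
  by case: maxX => _ /(_ Y XY); apply: contra; apply: tutte_extreme.
(* Supersets of [X] also have more than one element, so nice and extreme agree on them. *)
- case=> exX maxX; split=> [|Y XY]; first exact: extreme_nice.
  apply: contra (maxX Y XY); apply: nice_extreme => //.
  by apply: leq_trans gtX _; apply/subset_leq_card/proper_sub.
- case=> nX maxX; split=> [|Y XY]; first exact: nice_extreme.
  by apply: contra (maxX Y XY); apply: extreme_nice.
Qed.
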